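(* After a suitable rotation, the regular tetrahedron can be decomposed into two tetrahedra with orthogonally connected boundaries; that is, for a regular tetrahedron $T\subset\mathbb{R}^3$ there is a rotation $\rho$ of $\mathbb{R}^3$ such that $\rho(T)$ can be decomposed into two tetrahedra each of which has an orthogonally connected boundary.
   Context: A polygonal path in $\mathbb{R}^3$ is orthogonal if each of its edges is parallel to one of the coordinate axes. A set $S\subset\mathbb{R}^3$ is orthogonally connected if any two distinct points of $S$ are joined by an orthogonal path contained in $S$. A polytope is decomposed into polytopes $P_1,\dots,P_k$ if it is their union and their interiors are pairwise disjoint. *)

(* Defs.v *)
From HB Require Import structures.
From mathcomp Require Import all_boot all_order all_algebra.
From mathcomp Require Import all_classical all_reals all_analysis.

Set Implicit Arguments.
Unset Strict Implicit.
Unset Printing Implicit Defensive.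

Import Order.TTheory GRing.Theory Num.Theory.
Import numFieldNormedType.Exports.

Local Open Scope classical_set_scope.
Local Open Scope ring_scope.

(* Points of R^3 are row vectors 'rV[R]_3.  The library norm on them is the
   sup norm: it induces the usual topology, used for interior and closure, but
   lengths have to be measured with the Euclidean norm. *)
Definition euclidean_norm (R : realType) (x : 'rV[R]_3) : R :=
  Num.sqrt (\sum_i x 0 i ^+ 2).

Definition segment (R : realType) (p q : 'rV[R]_3) : set 'rV[R]_3 :=
  [set (1 - t) *: p + t *: q | t in `[0, 1]].

Definition convex_hull (R : realType) (n : nat) (v : 'I_n -> 'rV[R]_3) :
    set 'rV[R]_3 :=
  [set x | exists c : 'I_n -> R,
    [/\ forall i, 0 <= c i, \sum_i c i = 1 & x = \sum_i c i *: v i]].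

Definition boundary (R : realType) (S : set 'rV[R]_3) : set 'rV[R]_3 :=
  closure S `\` interior S.

(* %MS compares row spaces: q - p lies on the line spanned by a basis vector.
   The degenerate edge p = q is allowed. *)
Definition orthogonal_edge (R : realType) (p q : 'rV[R]_3) : bool :=
  [exists i : 'I_3, (q - p <= (delta_mx 0 i : 'rV[R]_3))%MS].

(* The union of the edges of the polygonal path with vertices p :: s. *)
Fixpoint polygonal_path (R : realType) (p : 'rV[R]_3) (s : seq 'rV[R]_3) :
    set 'rV[R]_3 :=
  if s is q :: s' then segment p q `|` polygonal_path q s' else [set p].

Definition orthogonally_connected (R : realType) (S : set 'rV[R]_3) : Prop :=
  forall p q : 'rV[R]_3, S p -> S q -> p != q ->
    exists s : seq 'rV[R]_3,
      [/\ path (@orthogonal_edge R) p s, last p s = q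
        & polygonal_path p s `<=` S].

Definition affinely_independent (R : realType) (n : nat)
    (v : 'I_n -> 'rV[R]_3) : Prop :=
  forall c : 'I_n -> R,
    \sum_i c i = 0 -> \sum_i c i *: v i = 0 -> forall i, c i = 0.

Definition tetrahedron (R : realType) (T : set 'rV[R]_3) : Prop :=
  exists v : 'I_4 -> 'rV[R]_3, affinely_independent v /\ T = convex_hull v.

Definition regular_tetrahedron (R : realType) (T : set 'rV[R]_3) : Prop :=
  exists v : 'I_4 -> 'rV[R]_3,
    [/\ affinely_independent v,
        exists l : R, forall i j, i != j -> euclidean_norm (v i - v j) = l
      & T = convex_hull v].

Definition decomposed_into (R : realType) (P : set 'rV[R]_3) (k : nat)
    (Q : 'I_k -> set 'rV[R]_3) : Prop :=
  P = \bigcup_i Q i /\ trivIset setT (fun i => interior (Q i)).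

(* Elements of SO(3), acting on row vectors by x |-> x *m M. *)
Definition rotation (R : realType) (M : 'M[R]_3) : Prop :=
  M *m M^T = 1%:M /\ \det M = 1.

(* Main.v *)
Require Import Defs.
From HB Require Import structures.
From mathcomp Require Import all_boot all_order all_algebra.
From mathcomp Require Import all_classical all_reals all_analysis.
From mathcomp Require Import ring lra.
Import Order.TTheory GRing.Theory Num.Theory.
Import numFieldNormedType.Exports.
Local Open Scope classical_set_scope.
Local Open Scope ring_scope.

(** A regular tetrahedron abcd has perpendicular opposite edges ab and cd, and
    the segment joining their midpoints f and m is perpendicular to both.  So a
    rotation makes ab, cd and fm parallel to the first, second and third axis
    ([rotation_regular_tetrahedron]).  The plane abm then cuts abcd into the
    tetrahedra abmc and abmd ([midpoint_decomposition]).

    In such a piece, say abmc, every facet contains an axis direction: ab in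
    abm and abc, cm in acm and bcm.  Moreover abm is parallel to a coordinate
    plane, as it also contains fm.  Hence a point of abc can be pushed
    along ab to the edge ac, a point of acm or bcm can be pushed along cm into
    abm, and a point of abm can be pushed along fm to the edge ab and then
    along it to a.  So every point of the boundary is joined to a
    ([orthogonally_connected_facets]).

    The topological input is that the boundary of a tetrahedron is the union of
    its facets ([boundary_tetrahedron]), which rests on the continuity of
    barycentric coordinates. *)

Set Implicit Arguments.
Unset Strict Implicit.
Unset Printing Implicit Defensive.

(** * Joining points by orthogonal paths *)

Definition joined (R : realType) (S : set 'rV[R]_3) (p q : 'rV[R]_3) : Prop :=
  exists s : seq 'rV[R]_3,
    [/\ path (@orthogonal_edge R) p s, last p s = q
      & polygonal_path p s `<=` S].

Lemma segmentP (R : realType) (p q x : 'rV[R]_3) :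
  segment p q x <->
  exists t : R, [/\ 0 <= t, t <= 1 & x = (1 - t) *: p + t *: q].
Proof.
split=> [[t /=]|[t [t0 t1 ->]]].
  by rewrite in_itv /= => /andP[t0 t1] <-; exists t.
by exists t; rewrite // /mkset /= in_itv /= t0 t1.
Qed.

Lemma segment_sym (R : realType) (p q : 'rV[R]_3) :
  segment p q `<=` segment q p.
Proof.
move=> x /segmentP[t [t0 t1 ->]].
apply/segmentP; exists (1 - t); split; [lra|lra|].
by rewrite subKr addrC.
Qed.

Lemma orthogonal_edge_parallel (R : realType) (k : R) (p q p' q' : 'rV[R]_3) :
  orthogonal_edge p q -> q' - p' = k *: (q - p) -> orthogonal_edge p' q'.
Proof.
by move=> /existsP[i pq] e; apply/existsP; exists i; rewrite e scalemx_sub.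
Qed.

Lemma orthogonal_edge_sym (R : realType) (p q : 'rV[R]_3) :
  orthogonal_edge p q -> orthogonal_edge q p.
Proof.
by move=> /(orthogonal_edge_parallel (k := -1)); apply; rewrite scaleN1r opprB.
Qed.

Lemma joined_edge (R : realType) (S : set 'rV[R]_3) (p q : 'rV[R]_3) :
  orthogonal_edge p q -> segment p q `<=` S -> joined S p q.
Proof.
move=> pq pqS; exists [:: q]; split=> //=; first by rewrite pq.
move=> x [/pqS//|->]; apply: pqS; apply/segmentP; exists 1; split=> //.
by rewrite subrr scale0r scale1r add0r.
Qed.

Lemma joined_trans (R : realType) (S : set 'rV[R]_3) (p q r : 'rV[R]_3) :
  joined S p q -> joined S q r -> joined S p r.
Proof.
move=> [s [sp <- sS]] [t [tp <- tS]]; exists (s ++ t); split.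
- by rewrite cat_path sp.
- by rewrite last_cat.
- elim: s p sS tS {sp tp} => [|x s IHs] p //= sS tS y [py|].
    by apply: sS; left.
  by apply: IHs => // z xsz; apply: sS; right.
Qed.

Lemma joined_sym (R : realType) (S : set 'rV[R]_3) (p q : 'rV[R]_3) :
  joined S p q -> joined S q p.
Proof.
move=> [s]; elim: s p => [|x s IHs] p [/= sp sq sS].
  by exists [::]; split=> //=; rewrite -sq.
case/andP: sp => px sp; apply: (@joined_trans _ S q x).
  by apply: IHs; split=> // y ys; apply: sS; right.
apply: joined_edge; first exact: orthogonal_edge_sym.
by move=> y /segment_sym py; apply: sS; left.
Qed.

Lemma orthogonally_connected_hub (R : realType) (S : set 'rV[R]_3)
    (o : 'rV[R]_3) :
  (forall p, S p -> joined S p o) -> orthogonally_connected S.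
Proof.
move=> So p q /So po /So qo _.
exact: (joined_trans po (joined_sym qo)).
Qed.

(** * Facets of a convex hull *)

Definition facet (R : realType) (n : nat) (v : 'I_n -> 'rV[R]_3) (i : 'I_n) :
    set 'rV[R]_3 :=
  [set x | exists c : 'I_n -> R,
    [/\ forall j, 0 <= c j, \sum_j c j = 1, x = \sum_j c j *: v j & c i = 0]].

(** Facets are convex, so an orthogonal edge whose ends share a facet stays in
    the boundary. *)
Lemma facet_segment (R : realType) (n : nat) (v : 'I_n -> 'rV[R]_3)
    (i : 'I_n) p q :
  facet v i p -> facet v i q -> segment p q `<=` facet v i.
Proof.
move=> [c [c0 c1 -> ci]] [d [d0 d1 -> di]] x /segmentP[t [t0 t1 ->]].
exists (fun j => (1 - t) * c j + t * d j); split.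
- by move=> j; rewrite addr_ge0// mulr_ge0// subr_ge0.
- by rewrite big_split/= -!mulr_sumr c1 d1; ring.
- rewrite !scaler_sumr -big_split/=; apply: eq_bigr => j _.
  by rewrite !scalerA -scalerDl.
- by rewrite ci di; ring.
Qed.

Definition quadruple (T : Type) (a b c d : T) (i : 'I_4) : T :=
  match val i with 0%N => a | 1%N => b | 2%N => c | _ => d end.

Lemma sum_quadruple (V : nmodType) (f : 'I_4 -> V) :
  \sum_i f i = f 0 + f 1 + f 2%:R + f 3%:R.
Proof.
rewrite !big_ord_recr big_ord0 /= add0r.
by congr (_ + _ + _ + _); congr f; apply/val_inj.
Qed.

Lemma forall_quadruple (P : 'I_4 -> Prop) :
  P 0 -> P 1 -> P 2%:R -> P 3%:R -> forall i, P i.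
Proof.
move=> P0 P1 P2 P3 [[|[|[|[|//]]]] i4].
- by rewrite (_ : Ordinal i4 = 0) //; apply/val_inj.
- by rewrite (_ : Ordinal i4 = 1) //; apply/val_inj.
- by rewrite (_ : Ordinal i4 = 2%:R) //; apply/val_inj.
- by rewrite (_ : Ordinal i4 = 3%:R) //; apply/val_inj.
Qed.

Lemma facet_quadruple (R : realType) (a b c d : 'rV[R]_3) (i : 'I_4)
    (x y z t : R) p :
  0 <= x -> 0 <= y -> 0 <= z -> 0 <= t -> x + y + z + t = 1 ->
  quadruple x y z t i = 0 ->
  p = x *: a + y *: b + z *: c + t *: d ->
  facet (quadruple a b c d) i p.
Proof.
move=> x0 y0 z0 t0 s1 i0 ->; exists (quadruple x y z t); split => //.
- exact: forall_quadruple.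
- by rewrite sum_quadruple.
- by rewrite sum_quadruple.
Qed.

Lemma facet_quadruple_inv (R : realType) (a b c d : 'rV[R]_3) (i : 'I_4) p :
  facet (quadruple a b c d) i p -> exists x y z t : R,
    [/\ [/\ 0 <= x, 0 <= y, 0 <= z & 0 <= t], x + y + z + t = 1,
        quadruple x y z t i = 0 & p = x *: a + y *: b + z *: c + t *: d].
Proof.
move=> [k [k0 k1 -> ki]]; exists (k 0), (k 1), (k 2%:R), (k 3%:R); split=> //.
- by rewrite -k1 sum_quadruple.
- by move: i ki; apply: forall_quadruple.
- by rewrite sum_quadruple.
Qed.

(** * Orthogonal connectedness of the union of facets *)

(** In this section [c] plays the part of the midpoint m of the cut edge
    and [d] that of the remaining vertex; the foot of [c] on the edge [a b] may
    be any point (1 - s) a + s b of it. *)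

Section orthogonally_connected_facets.
Variables (R : realType) (a b c d : 'rV[R]_3) (s : R).
Hypotheses (s0 : 0 <= s) (s1 : s <= 1).
Hypothesis ab : orthogonal_edge a b.
Hypothesis cd : orthogonal_edge c d.
Hypothesis fc : orthogonal_edge ((1 - s) *: a + s *: b) c.
Let v := quadruple a b c d.
Let S := \bigcup_i facet v i.

Let joined_facet i p q : facet v i p -> facet v i q ->
  orthogonal_edge p q -> joined S p q.
Proof.
move=> pi qi pq; apply: joined_edge => // x xpq.
by exists i => //; apply: facet_segment xpq.
Qed.

(** The triangle abc contains two axis directions: dropping [c] onto its foot
    leads to the edge ab, which leads to [a]. *)
Let joined_abc p : facet v 3%:R p -> joined S p a.
Proof.
move=> p3.
have [x [y [z [t [[x0 y0 z0 t0] e i0 pE]]]]] := facet_quadruple_inv p3.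
rewrite /quadruple /= in i0; subst t.
have q3 : facet v 3%:R ((x + z * (1 - s)) *: a + (y + z * s) *: b).
  apply: (@facet_quadruple _ _ _ _ _ _ (x + z * (1 - s)) (y + z * s) 0 0) => //.
  - by rewrite addr_ge0// mulr_ge0// subr_ge0.
  - by rewrite addr_ge0// mulr_ge0.
  - lra.
  - by rewrite !scale0r !addr0.
have a3 : facet v 3%:R a.
  apply: (@facet_quadruple _ _ _ _ _ _ 1 0 0 0) => //.
    by rewrite !addr0.
  by rewrite !scale0r !addr0 scale1r.
apply: joined_trans (joined_facet p3 q3 _) (joined_facet q3 a3 _).
  apply: (orthogonal_edge_parallel (k := - z) fc).
  by rewrite pE; apply/rowP => j; rewrite !mxE; ring.
apply: (orthogonal_edge_parallel (k := - (y + z * s)) ab).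
have -> : x = 1 - y - z by lra.
by apply/rowP => j; rewrite !mxE; ring.
Qed.

(** In bcd and acd, moving the weight of [d] onto [c] is a move along cd, and it
    ends on a side of abc. *)
Let joined_cd (i : 'I_4) p : i = 0 \/ i = 1 -> facet v i p -> joined S p a.
Proof.
move=> i01 pi.
have [x [y [z [t [[x0 y0 z0 t0] e i0 pE]]]]] := facet_quadruple_inv pi.
have q j :
    quadruple x y (z + t) 0 j = 0 -> facet v j (x *: a + y *: b + (z + t) *: c).
  move=> qj; apply: (@facet_quadruple _ _ _ _ _ _ x y (z + t) 0) => //.
  - exact: addr_ge0.
  - lra.
  - by rewrite scale0r !addr0.
have qi : quadruple x y (z + t) 0 i = 0.
  by move: i01 i0 => [->|->].
apply: joined_trans (joined_abc (q 3%:R erefl)).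
apply: (joined_facet pi (q i qi)).
apply: (orthogonal_edge_parallel (k := - t) cd).
by rewrite pE; apply/rowP => j; rewrite !mxE; ring.
Qed.

(** In abd, moving the weight of [b] onto [a] is a move along ab, and it ends on
    the edge ad, which also belongs to acd. *)
Let joined_ab p : facet v 2%:R p -> joined S p a.
Proof.
move=> p2.
have [x [y [z [t [[x0 y0 z0 t0] e i0 pE]]]]] := facet_quadruple_inv p2.
rewrite /quadruple /= in i0; subst z.
have q j : quadruple (x + y) 0 0 t j = 0 -> facet v j ((x + y) *: a + t *: d).
  move=> qj; apply: (@facet_quadruple _ _ _ _ _ _ (x + y) 0 0 t) => //.
  - exact: addr_ge0.
  - lra.
  - by rewrite !scale0r !addr0.
apply: joined_trans (joined_cd (or_intror erefl) (q 1 erefl)).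
apply: (joined_facet p2 (q 2%:R erefl)).
apply: (orthogonal_edge_parallel (k := - y) ab).
by rewrite pE; apply/rowP => j; rewrite !mxE; ring.
Qed.

Lemma orthogonally_connected_facets : orthogonally_connected S.
Proof.
apply: (@orthogonally_connected_hub _ _ a) => p [i _]; move: i.
apply: forall_quadruple.
- by apply: joined_cd; left.
- by apply: joined_cd; right.
- exact: joined_ab.
- exact: joined_abc.
Qed.

End orthogonally_connected_facets.

(** * The boundary of a tetrahedron *)

Lemma barycentric_coordinates_unique (R : realType) n
    (v : 'I_n -> 'rV[R]_3) c d :
  affinely_independent v -> \sum_i c i = \sum_i d i ->
  \sum_i c i *: v i = \sum_i d i *: v i -> c = d.
Proof.
move=> vi s e; apply/funext => i; apply/eqP; rewrite -subr_eq0; apply/eqP.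
move: i; apply: vi.
  by rewrite sumrB s subrr.
by under eq_bigr do rewrite scalerBl; rewrite sumrB e subrr.
Qed.

(** Appending a coordinate 1 to every point turns affine combinations into
    linear ones; the coordinates of x are then the entries of (x, 1) B^-1, where
    B has rows (v_i, 1), and B is invertible because the v_i are affinely
    independent. *)
Lemma barycentric_coordinates (R : realType) (v : 'I_4 -> 'rV[R]_3) :
  affinely_independent v -> exists l : 'rV[R]_3 -> 'I_4 -> R,
    [/\ forall i, continuous (fun x => l x i), forall x, \sum_i l x i = 1
      & forall x, x = \sum_i l x i *: v i].
Proof.
move=> vi; pose B : 'M[R]_(4, 3 + 1) := row_mx (\matrix_i v i) (const_mx 1).
have mulB (c : 'rV[R]_4) :
    c *m B = row_mx (\sum_i c 0 i *: v i) (\sum_i c 0 i)%:M.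
  rewrite mul_mx_row; congr row_mx.
    by rewrite mulmx_sum_row; apply: eq_bigr => i _; rewrite rowK.
  apply/rowP => j; rewrite !mxE ord1 eqxx mulr1n.
  by apply: eq_bigr => i _; rewrite mxE mulr1.
have Bu : (B : 'M[R]_4) \in unitmx.
  rewrite -row_free_unit; apply: inj_row_free => c; rewrite mulB => c0.
  have /eq_row_mx[e1 e2] : row_mx (\sum_i c 0 i *: v i) (\sum_i c 0 i)%:M =
    row_mx 0 0 :> 'rV[R]_(3 + 1) by rewrite c0 row_mx0.
  apply/rowP => i; rewrite mxE; apply: vi _ e1 _.
  by move/matrixP/(_ 0 0) : e2; rewrite !mxE mulr1n.
pose N : 'M[R]_(3 + 1, 4) := invmx (B : 'M[R]_4).
have lB x : (row_mx x 1%:M *m N) *m B = row_mx x 1%:M :> 'rV[R]_(3 + 1).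
  by rewrite -mulmxA /N mulVmx// mulmx1.
exists (fun x => (row_mx x 1%:M *m N) 0); split.
- move=> i x.
  have -> : (fun x : 'rV[R]_3 => (row_mx x 1%:M *m N) 0 i) =
    fun x => \sum_j x 0 j * usubmx N j i + dsubmx N 0 i.
    apply/funext => y; rewrite -{1}(vsubmxK N) mul_row_col mul1mx mxE.
    by rewrite mxE.
  apply: (@continuousD _ _ _ (fun y : 'rV[R]_3 => \sum_j y 0 j * usubmx N j i)
    (cst (dsubmx N 0 i))).
    move: x; apply: continuous_big; first exact: add_continuous.
    move=> j _ y; apply: (@continuousM _ _ (fun z : 'rV[R]_3 => z 0 j)
      (cst (usubmx N j i))).
      exact: coord_continuous.
    exact: cst_continuous.
  exact: cst_continuous.
- move=> x; move: (lB x); rewrite mulB => /eq_row_mx[_ /matrixP/(_ 0 0)].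
  by rewrite !mxE !mulr1n.
- by move=> x; move: (lB x); rewrite mulB => /eq_row_mx[].
Qed.

Lemma facet_hull (R : realType) n (v : 'I_n -> 'rV[R]_3) i :
  facet v i `<=` convex_hull v.
Proof. by move=> x [c [c0 c1 xE _]]; exists c. Qed.

(** Moving from a point of the facet opposite to v_i directly away from v_i
    makes the i-th barycentric coordinate negative at once. *)
Lemma facet_not_interior (R : realType) n (v : 'I_n -> 'rV[R]_3) i p :
  affinely_independent v -> facet v i p -> ~ interior (convex_hull v) p.
Proof.
move=> vi [c [c0 c1 pE ci]] pint.
have fc : (fun t : R => p + t *: (p - v i)) t @[t --> (0 : R)] --> p.
  rewrite -[X in _ --> X]addr0 -(scale0r (p - v i)).
  by apply: cvgD; [exact: cvg_cst | apply: cvgZr_tmp; exact: cvg_id].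
have [e e0 [d [d0 d1 dE]]] :
    exists2 e : R, 0 < e & convex_hull v (p + e *: (p - v i)).
  have /nbhs_ballP[e /= e0 eS] := fc _ (nbhs_interior pint).
  have e20 : 0 < e / 2 by rewrite divr_gt0.
  exists (e / 2) => //; apply: interior_subset; apply: eS.
  by rewrite /ball /= sub0r normrN gtr0_norm// ltr_pdivrMr// ltr_pMr// ltr1n.
suff : d = fun j => (1 + e) * c j - e * (j == i)%:R.
  move=> dc; have := d0 i.
  by rewrite dc ci eqxx mulr0 mulr1 sub0r oppr_ge0 leNgt e0.
have delta_sum (V : lmodType R) (F : 'I_n -> V) : \sum_j (j == i)%:R *: F j = F i.
  rewrite (bigD1 i)//= eqxx scale1r big1 ?addr0// => j /negbTE ->.
  by rewrite scale0r.
apply: (barycentric_coordinates_unique vi).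
  rewrite d1 sumrB -!mulr_sumr c1.
  have := delta_sum R^o (cst 1); rewrite /cst /=.
  under eq_bigr do rewrite -[_ *: _]/(_ * _) mulr1.
  move=> ->; ring.
rewrite -dE; under eq_bigr do rewrite scalerBl -!scalerA.
rewrite sumrB -!scaler_sumr delta_sum -pE.
by rewrite scalerDl scale1r scalerBr addrA.
Qed.

(** The hull is the set where all the continuous barycentric coordinates are
    nonnegative: it is closed, and a point where they are all positive is
    interior. *)
Lemma boundary_tetrahedron (R : realType) (v : 'I_4 -> 'rV[R]_3) :
  affinely_independent v -> boundary (convex_hull v) = \bigcup_i facet v i.
Proof.
move=> vi; have [l [lc l1 lE]] := barycentric_coordinates vi.
have hullE : convex_hull v = [set x | forall i, 0 <= l x i].
  apply/seteqP; split=> [x [c [c0 c1 xE]] i|x l0]; last by exists (l x).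
  suff -> : l x = c by [].
  by apply: (barycentric_coordinates_unique vi); rewrite ?l1 ?c1// -lE.
have hull_closed : closed (convex_hull v).
  rewrite hullE (_ : mkset _ = \bigcap_(i in setT) [set x | 0 <= l x i]).
    apply: closed_bigI => i _.
    apply: (@preimage_closed _ _ (fun x => l x i) [set y | 0 <= y]).
      by move=> x _; exact: lc.
    exact: closed_ge.
  by apply/seteqP; split=> x /= h i; [move=> _|]; exact: h.
rewrite /boundary -(proj1 (closure_id _) hull_closed).
apply/seteqP; split=> [x [xh xi]|x [i _ xi]]; last first.
  by split; [exact: facet_hull xi | exact: facet_not_interior xi].
have [i li0] : exists i, l x i = 0.
  apply: contrapT => /forallNP l_neq0; apply: xi; rewrite hullE.
  have : nbhs x [set y | forall i, 0 < l y i].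
    apply: (@filter_forall _ _ (fun i y => 0 < l y i) (nbhs x)) => i.
    apply: (cvgr_gt (l x i)); first exact: lc.
    rewrite lt_neqAle eq_sym; apply/andP; split; first exact/eqP/l_neq0.
    by move: xh; rewrite hullE; apply.
  by apply: filterS => y yl i; exact/ltW/yl.
exists i => //; exists (l x); split=> //.
by move: xh; rewrite hullE.
Qed.

(** * Cutting a tetrahedron through the midpoint of an edge *)

Lemma hull_quadrupleP (R : realType) (a b c d p : 'rV[R]_3) :
  convex_hull (quadruple a b c d) p <-> exists x y z t : R,
    [/\ [/\ 0 <= x, 0 <= y, 0 <= z & 0 <= t], x + y + z + t = 1
      & p = x *: a + y *: b + z *: c + t *: d].
Proof.
split=> [[k [k0 k1 ->]]|[x [y [z [t [[x0 y0 z0 t0] s1 ->]]]]]].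
  exists (k 0), (k 1), (k 2%:R), (k 3%:R); split=> //; last by rewrite sum_quadruple.
  by rewrite -k1 sum_quadruple.
exists (quadruple x y z t); split; rewrite ?sum_quadruple//.
exact: forall_quadruple.
Qed.

Lemma affinely_independent_quadrupleP (R : realType) (a b c d : 'rV[R]_3) :
  affinely_independent (quadruple a b c d) <->
  forall x y z t : R, x + y + z + t = 0 ->
    x *: a + y *: b + z *: c + t *: d = 0 -> [/\ x = 0, y = 0, z = 0 & t = 0].
Proof.
split=> [vi x y z t s0 e0|vi k].
  have k0 := vi (quadruple x y z t).
  rewrite !sum_quadruple in k0.
  by split; [exact: (k0 _ _ 0)|exact: (k0 _ _ 1)|exact: (k0 _ _ 2%:R)
            |exact: (k0 _ _ 3%:R)].
rewrite !sum_quadruple => s0 e0.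
by have [] := vi _ _ _ _ s0 e0; exact: forall_quadruple.
Qed.

Lemma affinely_independent_swap (R : realType) (a b c d : 'rV[R]_3) :
  affinely_independent (quadruple a b c d) ->
  affinely_independent (quadruple a b d c).
Proof.
move=> /affinely_independent_quadrupleP vi; apply/affinely_independent_quadrupleP.
move=> x y z t; rewrite -[LHS]addrA -[X in _ -> X = _ -> _]addrA.
rewrite (addrC z) (addrC (z *: d)) !addrA => s0 e0.
by have [] := vi _ _ _ _ s0 e0.
Qed.

Lemma affinely_independent_midpoint (R : realType) (a b c d : 'rV[R]_3) :
  affinely_independent (quadruple a b c d) ->
  affinely_independent (quadruple a b (2^-1 *: (c + d)) c).
Proof.
move=> /affinely_independent_quadrupleP vi; apply/affinely_independent_quadrupleP.
move=> x y z t s0 e0.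
have [||-> -> e1 e2] := vi x y (z / 2 + t) (z / 2).
- by rewrite -s0; field.
- by rewrite -e0; apply/rowP => j; rewrite !mxE; field.
by split=> //; lra.
Qed.

(** Since d = 2 m - c, a point of abmd has a nonpositive coordinate at c with
    respect to abmc, whereas the interior of abmc requires a positive one. *)
Lemma midpoint_halves_disjoint (R : realType) (a b c d p : 'rV[R]_3) :
  let m := 2^-1 *: (c + d) in
  affinely_independent (quadruple a b c d) ->
  interior (convex_hull (quadruple a b m c)) p ->
  convex_hull (quadruple a b m d) p -> False.
Proof.
move=> m vi pin /hull_quadrupleP[x' [y' [z' [t' [[x'0 y'0 z'0 t'0] s1' pE']]]]].
have mi := affinely_independent_midpoint vi.
have /hull_quadrupleP[x [y [z [t [[x0 y0 z0 t0] s1 pE]]]]] := interior_subset pin.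
have /affinely_independent_quadrupleP := mi.
(* The difference of the two expressions of p, with d replaced by 2 m - c. *)
move/(_ (x - x') (y - y') (z - z' - 2 * t') (t + t')) => [||_ _ _ tt'].
- by lra.
- apply/eqP; rewrite -[X in _ == X](subrr p) {1}pE pE'; apply/eqP/rowP => j.
  by rewrite !mxE; field.
have {}t0 : t = 0 by lra.
have /(facet_not_interior mi) : facet (quadruple a b m c) 3%:R p.
  by apply: (facet_quadruple x0 y0 z0 (lexx 0)); rewrite // -?t0.
exact.
Qed.

(** With m = (c + d) / 2, weights z and t on c and d with t <= z amount to 2 t
    on m and z - t on c; which piece contains a point depends on the larger of the
    two weights. *)
Lemma midpoint_decomposition (R : realType) (a b c d : 'rV[R]_3) :
  affinely_independent (quadruple a b c d) ->
  decomposed_into (convex_hull (quadruple a b c d))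
    (fun k : 'I_2 => convex_hull
      (quadruple a b (2^-1 *: (c + d)) (if k == 0 then c else d))).
Proof.
move=> vi; split.
  apply/seteqP; split=> p.
    move=> /hull_quadrupleP[x [y [z [t [[x0 y0 z0 t0] s1 pE]]]]].
    have [tz|/ltW zt] := leP t z; [exists 0 => //=|exists 1 => //=];
      apply/hull_quadrupleP.
    - exists x, y, (2 * t), (z - t); split; [by split=> //; lra|lra|].
      by rewrite pE; apply/rowP => j; rewrite !mxE; field.
    - exists x, y, (2 * z), (t - z); split; [by split=> //; lra|lra|].
      by rewrite pE; apply/rowP => j; rewrite !mxE; field.
  move=> [k _ /hull_quadrupleP[x [y [z [t [[x0 y0 z0 t0] s1 pE]]]]]].
  apply/hull_quadrupleP; case: eqP pE => _ pE.
  - exists x, y, (z / 2 + t), (z / 2); split; [by split=> //; lra|lra|].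
    by rewrite pE; apply/rowP => j; rewrite !mxE; field.
  - exists x, y, (z / 2), (z / 2 + t); split; [by split=> //; lra|lra|].
    by rewrite pE; apply/rowP => j; rewrite !mxE; field.
move=> i j _ _ [p [pin pj]]; apply/eqP; apply: contraT => ij; exfalso.
move: pin pj; case: ifPn => [i0|i0]; case: ifPn => [j0|j0] pin pj.
- by rewrite (eqP i0) (eqP j0) in ij.
- exact: (midpoint_halves_disjoint vi) pin (interior_subset pj).
- exact: (midpoint_halves_disjoint vi) pj (interior_subset pin).
- by case: i j i0 j0 ij {pin pj} => [[|[|//]] ?] [[|[|//]] ?].
Qed.

(** * Rotating a regular tetrahedron *)

Lemma forall_ord3 (P : 'I_3 -> Prop) : P 0 -> P 1 -> P 2%:R -> forall i, P i.
Proof.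
move=> P0 P1 P2 [[|[|[|//]]] i3].
- by rewrite (_ : Ordinal i3 = 0) //; apply/val_inj.
- by rewrite (_ : Ordinal i3 = 1) //; apply/val_inj.
- by rewrite (_ : Ordinal i3 = 2%:R) //; apply/val_inj.
Qed.

Lemma sum_ord3 (V : nmodType) (f : 'I_3 -> V) :
  \sum_i f i = f 0 + f 1 + f 2%:R.
Proof.
rewrite !big_ord_recr big_ord0 /= add0r.
by congr (_ + _ + _); congr f; apply/val_inj.
Qed.

(** Entries are indexed by [nat] so that the indices of minors compute. *)
Lemma det_mx33 (R : comPzRingType) (a : nat -> nat -> R) :
  \det (\matrix_(i < 3, j < 3) a i j) =
    a 0 0 * (a 1 1 * a 2 2 - a 1 2 * a 2 1)
    - a 0 1 * (a 1 0 * a 2 2 - a 1 2 * a 2 0)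
    + a 0 2 * (a 1 0 * a 2 1 - a 1 1 * a 2 0) :> R.
Proof.
rewrite (expand_det_row _ 0) !big_ord_recl big_ord0 /cofactor.
rewrite !(expand_det_row _ (0 : 'I_2)) !big_ord_recl !big_ord0.
rewrite /cofactor !det_mx11 !mxE /=.
rewrite /bump /= !addn0 !add0n !addn1 /=.
ring.
Qed.

Lemma mul_row_trE (R : realType) (x y : 'rV[R]_3) :
  (x *m y^T) 0 0 = x 0 0 * y 0 0 + x 0 1 * y 0 1 + x 0 2%:R * y 0 2%:R.
Proof. by rewrite mxE sum_ord3 !mxE. Qed.

(** The columns of M are u, w and the cross product of u and w, which has the
    right orientation. *)
Lemma rotation_onto_axes (R : realType) (u w : 'rV[R]_3) :
  u *m u^T = 1%:M -> w *m w^T = 1%:M -> u *m w^T = 0 ->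
  exists M : 'M[R]_3,
    [/\ rotation M, u *m M = delta_mx 0 0 & w *m M = delta_mx 0 1].
Proof.
move=> /matrixP/(_ 0 0); rewrite mul_row_trE mxE => uu.
move=> /matrixP/(_ 0 0); rewrite mul_row_trE mxE => ww.
move=> /matrixP/(_ 0 0); rewrite mul_row_trE mxE => uw.
set x := u 0 0 in uu uw; set y := u 0 1 in uu uw; set z := u 0 2%:R in uu uw.
set x' := w 0 0 in ww uw; set y' := w 0 1 in ww uw; set z' := w 0 2%:R in ww uw.
rewrite /= in uu ww.
pose n := [:: y * z' - z * y'; z * x' - x * z'; x * y' - y * x'].
pose a i j : R := nth 0 (nth [::] [:: [:: x; y; z]; [:: x'; y'; z']; n] i) j.
pose U : 'M[R]_3 := \matrix_(i < 3, j < 3) a i j.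
have nn :
    (y * z' - z * y') ^+ 2 + (z * x' - x * z') ^+ 2 + (x * y' - y * x') ^+ 2 = 1.
  (* Lagrange's identity for the norm of a cross product. *)
  transitivity ((x * x + y * y + z * z) * (x' * x' + y' * y' + z' * z') -
     (x * x' + y * y' + z * z') ^+ 2); first by ring.
  by rewrite uu ww uw; ring.
have UU : U *m U^T = 1%:M.
  apply/matrixP; do 2 apply: forall_ord3;
    rewrite !mxE sum_ord3 !mxE /a /= ?mulr0n ?mulr1n.
  - by [].
  - by [].
  - by ring.
  - by rewrite -uw; ring.
  - by [].
  - by ring.
  - by ring.
  - by ring.
  - by rewrite -nn; ring.
have UrowE (v : 'rV[R]_3) (i : 'I_3) :
    (forall j : 'I_3, v 0 j = a i j) -> v *m U^T = delta_mx 0 i.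
  move=> vE; rewrite -[RHS]mulmx1 -UU mulmxA -rowE; congr (_ *m _).
  by apply/rowP => j; rewrite !mxE vE.
exists U^T; split.
- split; first by rewrite trmxK; exact: mulmx1C.
  rewrite det_tr det_mx33 -nn /a /=; ring.
- by apply: UrowE; exact: forall_ord3.
- by apply: UrowE; exact: forall_ord3.
Qed.

Lemma affinely_independent_mulmx (R : realType) n (v : 'I_n -> 'rV[R]_3)
    (M : 'M[R]_3) :
  M \in unitmx -> affinely_independent v ->
  affinely_independent (fun i => v i *m M).
Proof.
move=> Mu vi c c0 cv; apply: vi => //; apply: (can_inj (mulmxK Mu)).
by rewrite mul0mx mulmx_suml -[RHS]cv; apply: eq_bigr => i _; rewrite scalemxAl.
Qed.

Lemma convex_hull_mulmx (R : realType) n (v : 'I_n -> 'rV[R]_3) (M : 'M[R]_3) :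
  [set x *m M | x in convex_hull v] = convex_hull (fun i => v i *m M).
Proof.
have imE (c : 'I_n -> R) : (\sum_i c i *: v i) *m M = \sum_i c i *: (v i *m M).
  by rewrite mulmx_suml; apply: eq_bigr => i _; rewrite scalemxAl.
apply/seteqP; split=> [_ [x [c [c0 c1 ->]] <-]|_ [c [c0 c1 ->]]].
  by exists c; rewrite imE.
by exists (\sum_i c i *: v i) => //; exists c.
Qed.

Lemma quadruple_eta (T : Type) (v : 'I_4 -> T) :
  v = quadruple (v 0) (v 1) (v 2%:R) (v 3%:R).
Proof. by apply/funext; exact: forall_quadruple. Qed.

(** Inner products of differences of points are combinations of squared
    distances, which are here all equal to l^2, so that they cancel: for
    instance
    2 <b - a, d - c> = |a - d|^2 + |b - c|^2 - |a - c|^2 - |b - d|^2 = 0.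
    Thus u = (b - a) / l and w = (d - c) / l are orthonormal and both orthogonal
    to n, the difference of the midpoints.  A rotation that maps u and w to the
    first two basis vectors hence maps n into the third axis. *)
Lemma rotation_regular_tetrahedron (R : realType) (a b c d : 'rV[R]_3) (l : R) :
  a != b ->
  {in [:: a - b; a - c; a - d; b - c; b - d; c - d],
    forall x, euclidean_norm x = l} ->
  exists M : 'M[R]_3, [/\ rotation M, orthogonal_edge (a *m M) (b *m M),
    orthogonal_edge (c *m M) (d *m M) &
    orthogonal_edge (2^-1 *: (a *m M + b *m M)) (2^-1 *: (c *m M + d *m M))].
Proof.
move=> ab abcd.
have norm_sqr (x : 'rV[R]_3) :
    x \in [:: a - b; a - c; a - d; b - c; b - d; c - d] ->
    (x *m x^T) 0 0 = l ^+ 2.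
  move=> /abcd <-; rewrite sqr_sqrtr ?sumr_ge0// => [|i _]; last exact: sqr_ge0.
  by rewrite mxE; apply: eq_bigr => i _; rewrite mxE expr2.
have l0 : l != 0.
  apply: contraNneq ab => l0.
  have := norm_sqr (a - b); rewrite inE eqxx => /(_ isT); rewrite l0 expr0n /= mxE.
  under eq_bigr do rewrite [_^T _ _]mxE -expr2.
  move/eqP; rewrite psumr_eq0 => [/allP ab0|i _]; last exact: sqr_ge0.
  rewrite -subr_eq0; apply/eqP/rowP => i; rewrite [RHS]mxE; apply/eqP.
  by have := ab0 i (mem_index_enum i); rewrite /= sqrf_eq0.
have [ab2 [ac2 [ad2 [bc2 [bd2 cd2]]]]] : ((a - b) *m (a - b)^T) 0 0 = l ^+ 2 /\
  ((a - c) *m (a - c)^T) 0 0 = l ^+ 2 /\ ((a - d) *m (a - d)^T) 0 0 = l ^+ 2 /\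
  ((b - c) *m (b - c)^T) 0 0 = l ^+ 2 /\ ((b - d) *m (b - d)^T) 0 0 = l ^+ 2 /\
  ((c - d) *m (c - d)^T) 0 0 = l ^+ 2.
  by do !split; apply: norm_sqr; rewrite !inE eqxx ?orbT.
rewrite !mul_row_trE !mxE in ab2 ac2 ad2 bc2 bd2 cd2.
pose u := l^-1 *: (b - a); pose w := l^-1 *: (d - c).
pose n := 2^-1 *: (c + d) - 2^-1 *: (a + b).
have mx11P (A B : 'M[R]_1) : A 0 0 = B 0 0 -> A = B.
  by move=> AB; apply/matrixP => i j; rewrite !ord1.
have uu : u *m u^T = 1%:M.
  apply: mx11P; rewrite mul_row_trE !mxE mulr1n.
  rewrite -[RHS](divff (expf_neq0 2 l0)) -[X in _ = X / _]ab2.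
  by field.
have ww : w *m w^T = 1%:M.
  apply: mx11P; rewrite mul_row_trE !mxE mulr1n.
  rewrite -[RHS](divff (expf_neq0 2 l0)) -[X in _ = X / _]cd2.
  by field.
have uw : u *m w^T = 0.
  apply: mx11P; rewrite mul_row_trE !mxE.
  rewrite -[RHS](mul0r (l ^- 2 / 2)).
  have <- : l ^+ 2 + l ^+ 2 - l ^+ 2 - l ^+ 2 = 0 by ring.
  rewrite -[X in X + _ - _ - _]ad2 -[X in _ + X - _ - _]bc2
    -[X in _ - X - _]ac2 -[X in _ - X]bd2.
  by field.
have un : n *m u^T = 0.
  apply: mx11P; rewrite mul_row_trE !mxE.
  rewrite -[RHS](mul0r (l ^-1 / 4)).
  have <- : l ^+ 2 + l ^+ 2 - l ^+ 2 - l ^+ 2 = 0 by ring.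
  rewrite -[X in X + _ - _ - _]ad2 -[X in _ + X - _ - _]ac2
    -[X in _ - X - _]bc2 -[X in _ - X]bd2.
  by field.
have wn : n *m w^T = 0.
  apply: mx11P; rewrite mul_row_trE !mxE.
  rewrite -[RHS](mul0r (l ^-1 / 4)).
  have <- : l ^+ 2 + l ^+ 2 - l ^+ 2 - l ^+ 2 = 0 by ring.
  rewrite -[X in X + _ - _ - _]ad2 -[X in _ + X - _ - _]bd2
    -[X in _ - X - _]ac2 -[X in _ - X]bc2.
  by field.
have [M [rotM uM wM]] := rotation_onto_axes uu ww uw.
have dotM (x y : 'rV[R]_3) : x *m y^T = (x *m M) *m (y *m M)^T.
  by rewrite trmx_mul mulmxA -(mulmxA x) rotM.1 mulmx1.
exists M; split=> //.
- apply/existsP; exists 0; rewrite -mulmxBl -uM /u -scalemxAl.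
  by rewrite eqmx_scale ?invr_eq0.
- apply/existsP; exists 1; rewrite -mulmxBl -wM /w -scalemxAl.
  by rewrite eqmx_scale ?invr_eq0.
- apply/existsP; exists 2%:R; apply/sub_rVP; exists ((n *m M) 0 2%:R).
  rewrite -!mulmxDl !scalemxAl -mulmxBl -/n.
  have nM0 (i : 'I_3) (x : 'rV[R]_3) : x *m M = delta_mx 0 i -> n *m x^T = 0 ->
      (n *m M) 0 i = 0.
    move=> xM; rewrite dotM xM => /matrixP/(_ 0 0).
    by rewrite trmx_delta -colE !mxE.
  apply/rowP; apply: forall_ord3;
    rewrite [RHS]mxE [X in _ = _ * X]mxE /= ?mulr0 ?mulr1//.
  + exact: nM0 uM un.
  + exact: nM0 wM wn.
Qed.

Unset Implicit Arguments.

Theorem corollary4p4 (R : realType) (T : set 'rV[R]_3)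
    (hT : regular_tetrahedron T) :
  exists M : 'M[R]_3, rotation M /\
    exists Q : 'I_2 -> set 'rV[R]_3,
      [/\ forall i, tetrahedron (Q i),
          decomposed_into [set x *m M | x in T] Q
        & forall i, orthogonally_connected (boundary (Q i))].
Proof.
case: hT => v [vi [l vl] ->].
have [||M [rotM abM cdM nM]] :=
  @rotation_regular_tetrahedron R (v 0) (v 1) (v 2%:R) (v 3%:R) l.
- apply/eqP => v01.
  have : affinely_independent (quadruple (v 0) (v 1) (v 2%:R) (v 3%:R)).
    by rewrite -quadruple_eta.
  move=> /affinely_independent_quadrupleP/(_ 1 (-1) 0 0)[||/eqP];
    last by rewrite oner_eq0.
    by rewrite subrr !addr0.
  by rewrite v01 scaleN1r scale1r subrr !scale0r !addr0.
- by move=> x; rewrite !inE; do ![case/orP]; move=> /eqP->; apply: vl.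
have Mu : M \in unitmx by have [/mulmx1_unit[]] := rotM.
exists M; split=> //.
have := affinely_independent_mulmx Mu vi.
rewrite convex_hull_mulmx (quadruple_eta (fun i => v i *m M)).
move: (v 0 *m M) (v 1 *m M) (v 2%:R *m M) (v 3%:R *m M) abM cdM nM.
move=> a b c d ab cd nM abcd.
exists (fun k : 'I_2 => convex_hull
      (quadruple a b (2^-1 *: (c + d)) (if k == 0 then c else d))).
have Qi (k : 'I_2) : affinely_independent
    (quadruple a b (2^-1 *: (c + d)) (if k == 0 then c else d)).
  case: ifP => _; first exact: affinely_independent_midpoint.
  by rewrite addrC; apply/affinely_independent_midpoint/affinely_independent_swap.
split.
- by move=> k; eexists; split; [exact: Qi | reflexivity].
- exact: midpoint_decomposition.
move=> k; rewrite boundary_tetrahedron//.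
apply: (@orthogonally_connected_facets _ _ _ _ _ 2^-1); [lra|lra|done| |].
- case: ifP => _; last first.
    apply: (orthogonal_edge_parallel (k := 2^-1) cd).
    by apply/rowP => j; rewrite !mxE; field.
  apply: (orthogonal_edge_parallel (k := - 2^-1) cd).
  by apply/rowP => j; rewrite !mxE; field.
- apply: (orthogonal_edge_parallel (k := 1) nM).
  by apply/rowP => j; rewrite !mxE; field.
Qed.
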